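(* Let $X$ be a metrizable space and let $\mathcal{S}$ be a bornology on $X$. Suppose $d,\rho$ are two compatible metrics on $X$. Consider the following statements: (i) $\tau_{\mathcal{S},d}^+\supseteq\tau_{\mathcal{S},\rho}^+$ on $CL(X)$; (ii) $(\mathcal{S}$-$d)\geqslant(\mathcal{S}$-$\rho)$ on $CL(X)$; (iii) $(\mathcal{S}$-$d)^+\geqslant(\mathcal{S}$-$\rho)^+$ on $CL(X)$. Then (i) implies (ii), and (ii) and (iii) are equivalent.
   Context: All metric (metrizable) spaces have at least two points. A bornology on $X$ is a family of nonempty subsets of $X$ that covers $X$, is closed under finite unions, and is closed under taking nonempty subsets of its members. $CL(X)$ is the set of nonempty closed subsets of $X$. For a metric $d$, $d(x,A)=\inf\{d(x,a):a\in A\}$ and $B_d(A,\epsilon)=\{x\in X:d(x,A)<\epsilon\}$. The topology $\tau_{\mathcal{S},d}^+$ on $CL(X)$ has as neighborhood base at $A$ the sets $\{C\in CL(X): d(x,A)-d(x,C)<\epsilon\ \forall x\in S\}$, $S\in\mathcal{S}$, $\epsilon>0$. A net $(A_\lambda)$ in $CL(X)$ is $(\mathcal{S}$-$d)^+$-convergent to $A\in CL(X)$ if for each $\epsilon>0$ and $S\in\mathcal{S}$, eventually $A_\lambda\cap S\subseteq B_d(A,\epsilon)$; it is $(\mathcal{S}$-$d)$-convergent to $A$ if for each $\epsilon>0$ and $S\in\mathcal{S}$, eventually both $A_\lambda\cap S\subseteq B_d(A,\epsilon)$ and $A\cap S\subseteq B_d(A_\lambda,\epsilon)$. For two convergences,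 $\mathcal{C}_1\geqslant\mathcal{C}_2$ on $CL(X)$ means that every net in $CL(X)$ that is $\mathcal{C}_1$-convergent to some $A\in CL(X)$ is also $\mathcal{C}_2$-convergent to $A$. *)

(* Defs.v *)
From HB Require Import structures.
From mathcomp Require Import all_boot all_order all_algebra.
From mathcomp Require Import all_classical all_reals.
From mathcomp Require Import topology.

Set Implicit Arguments.
Unset Strict Implicit.
Unset Printing Implicit Defensive.

Import Order.TTheory GRing.Theory Num.Theory.
Local Open Scope classical_set_scope.
Local Open Scope ring_scope.

(* [metricType] attaches one metric to one carrier; several metrics on the same
   space have to be compared here, so a metric is a predicate on functions. *)
Record is_metric (R : realType) (X : Type) (d : X -> X -> R) : Prop := IsMetric {
  metric_ge0 : forall x y, 0 <= d x y;
  metric_eq0 : forall x y, d x y = 0 <-> x = y;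
  metric_sym : forall x y, d x y = d y x;
  metric_triangle : forall x y z, d x z <= d x y + d y z
}.

Definition compatible_metric (R : realType) (X : topologicalType)
    (d : X -> X -> R) : Prop :=
  is_metric d /\
  forall U : set X,
    open U <-> forall x, U x -> exists2 e : R, 0 < e & [set y | d x y < e] `<=` U.

Record bornology (X : Type) (S : set (set X)) : Prop := Bornology {
  bornology_nonempty : forall A, S A -> A !=set0;
  bornology_cover : \bigcup_(A in S) A = setT;
  bornology_setU : forall A B, S A -> S B -> S (A `|` B);
  bornology_subset : forall A B, S A -> B `<=` A -> B !=set0 -> S B
}.

Definition CL (X : topologicalType) : set (set X) :=
  [set A | closed A /\ A !=set0].

(* [inf] takes the junk value 0 at the empty set; [dist d x A] is only used for
   [A] in [CL X]. *)
Definition dist (R : realType) (X : Type) (d : X -> X -> R) (x : X) (A : set X) : R :=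
  inf [set d x a | a in A].

Definition enlargement (R : realType) (X : Type) (d : X -> X -> R)
    (A : set X) (e : R) : set X :=
  [set x | dist d x A < e].

Definition upper_nbhd (R : realType) (X : topologicalType) (d : X -> X -> R)
    (A B : set X) (e : R) : set (set X) :=
  [set C | CL C /\ forall x, B x -> dist d x A - dist d x C < e].

(* The topology on [CL X], as its family of open sets, having the sets
   [upper_nbhd d A B e] as neighborhood base at [A]; see [tau_plus_nbhd_base]. *)
Definition tau_plus (R : realType) (X : topologicalType) (S : set (set X))
    (d : X -> X -> R) : set (set (set X)) :=
  [set U | U `<=` @CL X /\
    forall A, U A -> exists2 B, S B &
      exists2 e : R, 0 < e & upper_nbhd d A B e `<=` U].

Definition directed (I : Type) (le : I -> I -> Prop) : Prop :=
  [/\ exists i : I, True,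
      forall i, le i i,
      forall i j k, le i j -> le j k -> le i k &
      forall i j, exists2 k, le i k & le j k].

Definition eventually_net (I : Type) (le : I -> I -> Prop) (P : I -> Prop) : Prop :=
  exists i0, forall i, le i0 i -> P i.

Definition convergence (X : Type) : Type :=
  forall (I : Type) (le : I -> I -> Prop), (I -> set X) -> set X -> Prop.

Definition bconv_plus (R : realType) (X : Type) (S : set (set X))
    (d : X -> X -> R) : convergence X :=
  fun I le F A => forall (e : R) (B : set X), 0 < e -> S B ->
    eventually_net le (fun i => F i `&` B `<=` enlargement d A e).

Definition bconv (R : realType) (X : Type) (S : set (set X))
    (d : X -> X -> R) : convergence X :=
  fun I le F A => forall (e : R) (B : set X), 0 < e -> S B ->
    eventually_net le (fun i => F i `&` B `<=` enlargement d A e /\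
                                A `&` B `<=` enlargement d (F i) e).

Definition finer_convergence (X : topologicalType) (C1 C2 : convergence X) : Prop :=
  forall (I : Type) (le : I -> I -> Prop) (F : I -> set X) (A : set X),
    directed le -> (forall i, CL (F i)) -> CL A ->
    C1 I le F A -> C2 I le F A.

Section TauPlus.
Variables (R : realType) (X : topologicalType) (S : set (set X)) (d : X -> X -> R).
Hypotheses (bS : bornology S).

Lemma tau_plus_set0 : tau_plus S d set0.
Proof. by split. Qed.

Lemma tau_plus_CL : inhabited X -> tau_plus S d (@CL X).
Proof.
move=> [x0]; split=> // A _.
have : [set: X] x0 by [].
rewrite -(bornology_cover bS) => -[B SB _].
by exists B => //; exists 1 => // C [].
Qed.

Lemma tau_plus_bigcup (F : set (set (set X))) :
  F `<=` tau_plus S d -> tau_plus S d (\bigcup_(U in F) U).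
Proof.
move=> Fo; split; first by move=> A [U /Fo[+ _]]; apply.
move=> A [U FU UA]; have [_ /(_ _ UA)[B SB [e e0 sub]]] := Fo _ FU.
by exists B => //; exists e => // C /sub UC; exists U.
Qed.

Lemma tau_plus_setI (U V : set (set X)) :
  tau_plus S d U -> tau_plus S d V -> tau_plus S d (U `&` V).
Proof.
move=> [UCL Uo] [VCL Vo]; split; first by move=> A [/UCL].
move=> A [/Uo[B SB [e e0 subU]] /Vo[B' SB' [e' e'0 subV]]].
exists (B `|` B'); first exact: bornology_setU.
exists (Num.min e e'); first by rewrite lt_min e0.
move=> C [CC h]; split.
- by apply: subU; split=> // x Bx; have := h x (or_introl Bx); rewrite lt_min => /andP[].
- by apply: subV; split=> // x Bx; have := h x (or_intror Bx); rewrite lt_min => /andP[].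
Qed.

Lemma tau_plus_nbhd_base (A : set X) (W : set (set X)) : CL A -> W `<=` @CL X ->
  (exists U, [/\ tau_plus S d U, U A & U `<=` W]) <->
  (exists2 B, S B & exists2 e : R, 0 < e & upper_nbhd d A B e `<=` W).
Proof.
move=> CA WCL; split.
  move=> [U [[_ Uo] UA UW]]; have [B SB [e e0 sub]] := Uo _ UA.
  by exists B => //; exists e => // C /sub /UW.
move=> [B SB [e e0 sub]].
exists [set C | CL C /\ exists2 r, r < e &
                  forall x, B x -> dist d x A - dist d x C <= r].
split.
- split; first by move=> C [].
  move=> C [CC [r re h]]; exists B => //; exists ((e - r) / 2).
    by rewrite divr_gt0 // subr_gt0.
  move=> D [CD hD]; split=> //; exists (r + (e - r) / 2).
    by rewrite -ltrBrDl ltr_pdivrMr // ltr_pMr ?subr_gt0 // ltr1n.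
  move=> x Bx.
  rewrite -(subrKA (dist d x C)) lerD ?h //; exact/ltW/hD.
- by split=> //; exists 0 => // x _; rewrite subrr.
- move=> C [CC [r re h]]; apply: sub; split=> // x Bx.
  exact: le_lt_trans (h x Bx) re.
Qed.

End TauPlus.

(* Main.v *)
(** All three statements are compared with a single uniform condition on the
    members [B] of the bornology: for every [e > 0] there is [r > 0] such that
    [d x y < r] implies [rho x y < e] whenever [x] is in [B] and [y] is anywhere.
    It clearly yields (ii) and (iii).  Conversely, testing (i), (ii) or (iii) on
    the sets [A `|` [set x]], with [x] in [B] and [d]-close to [A], shows that
    points of [B] that are [d]-close to a closed set [A] are [rho]-close to it.
    Efremovich's lemma upgrades this to the uniform condition: if [d (a n) (y n)]
    tends to 0 while [rho (a n) (y n) >= e], then along a subsequence all the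
    [y n] stay [rho]-away from all the [a m], and hence lie in a closed set to
    which the [a m] are [d]-close but not [rho]-close. *)

Require Import Defs.
From mathcomp Require Import all_boot all_order all_algebra.
From mathcomp Require Import all_classical all_reals.
From mathcomp Require Import topology.
From mathcomp Require Import lra.

Import Order.TTheory GRing.Theory Num.Theory.

Local Open Scope classical_set_scope.

Lemma natSinv_lt (R : realType) (r : R) : (0 < r)%R ->
  exists N, forall n, (N <= n)%N -> (n.+1%:R^-1 < r)%R.
Proof.
move=> r0; have [N] := ltr_add_invr r0; rewrite add0r => hN; exists N => n Nn.
by apply: le_lt_trans hN; rewrite lef_pV2 ?posrE ?ltr0n // ler_nat ltnS.
Qed.

(** * Distance to a set and Efremovich's lemma, in one metric *)

Section Metric.
Local Open Scope ring_scope.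
Context {R : realType} {X : Type} {d : X -> X -> R}.
Hypothesis dM : is_metric d.

Lemma dist_le x (A : set X) a : A a -> dist d x A <= d x a.
Proof.
move=> Aa; apply: ge_inf; last by exists a.
by exists 0 => _ [b _ <-]; exact: Defs.metric_ge0.
Qed.

Lemma dist_ge x (A : set X) r :
  A !=set0 -> (forall a, A a -> r <= d x a) -> r <= dist d x A.
Proof.
move=> [a Aa] h; apply: lb_le_inf; first by exists (d x a); exists a.
by move=> _ [b Ab <-]; exact: h.
Qed.

Lemma dist_ltP x (A : set X) e : A !=set0 ->
  dist d x A < e <-> exists2 a, A a & d x a < e.
Proof.
move=> A0; split=> [xAe|[a Aa]]; last exact/le_lt_trans/dist_le.
apply: contrapT => h; move: xAe; apply/negP; rewrite -leNgt.
apply: dist_ge => // a Aa; rewrite leNgt; apply/negP => xae.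
by apply: h; exists a.
Qed.

Lemma dist_mem x (A : set X) : A x -> dist d x A <= 0.
Proof. by move=> /(dist_le x); rewrite (Defs.metric_eq0 dM x x).2. Qed.

Lemma dist_triangle x y (A : set X) :
  A !=set0 -> dist d x A <= d x y + dist d y A.
Proof.
move=> A0; rewrite -lerBlDl; apply: dist_ge => // a Aa.
rewrite lerBlDl; apply: (le_trans (dist_le _ _ _ Aa)).
exact: Defs.metric_triangle.
Qed.

(** The bound is uniform in [z]: it controls the enlarged set over every member of a bornology at
    once. *)
Lemma dist_setU1 x z (A : set X) :
  A !=set0 -> dist d z A - dist d x A <= dist d z (A `|` [set x]).
Proof.
move=> A0; apply: dist_ge; first by exists x; right.
move=> c [Ac|->]; last by rewrite lerBlDr dist_triangle.
rewrite lerBlDr; apply: (le_trans (dist_le _ _ _ Ac)); rewrite lerDl.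
by apply: dist_ge => // a _; exact: Defs.metric_ge0.
Qed.

(** If every separated index set were bounded, so would be a maximal one given by Zorn's lemma; a
    large enough index could then still be added to it. *)
Lemma efremovich (a y : nat -> X) e : 0 < e ->
  (forall n, e <= d (a n) (y n)) ->
  exists2 J : set nat, (forall N, exists2 n, (N <= n)%N & J n) &
    forall m n, J m -> J n -> e / 4 <= d (a m) (y n).
Proof.
move=> e0 aye.
pose sep (J : set nat) := forall m n, J m -> J n -> e / 4 <= d (a m) (y n).
suff: exists2 J : set nat, (forall N, exists2 n, (N <= n)%N & J n) & sep J by [].
apply: contrapT => noJ.
have bounded J : sep J -> exists N, forall n, J n -> (n < N)%N.
  move=> sJ; apply: contrapT => /forallNP h; apply: noJ; exists J => // N.
  by have /existsNP[n /not_implyP[Jn /negP]] := h N; rewrite -leqNgt; exists n.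
(* The indices at which one of the sequences stays in a fixed small ball form a
   separated set. *)
have far m : exists N, forall n, (N <= n)%N ->
    e / 4 <= d (a n) (y m) /\ e / 4 <= d (a m) (y n).
  have [|N1 h1] := bounded [set n | d (a n) (y m) < e / 4].
    move=> k l /= kb lb.
    have := Defs.metric_triangle dM (a l) (y m) (y l).
    have := Defs.metric_triangle dM (y m) (a k) (y l).
    rewrite (Defs.metric_sym dM (y m) (a k)); have := aye l; lra.
  have [|N2 h2] := bounded [set n | d (a m) (y n) < e / 4].
    move=> k l /= kb lb.
    have := Defs.metric_triangle dM (a k) (y l) (y k).
    have := Defs.metric_triangle dM (y l) (a m) (y k).
    rewrite (Defs.metric_sym dM (y l) (a m)); have := aye k; lra.
  exists (maxn N1 N2) => n; rewrite geq_max => /andP[N1n N2n].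
  split; rewrite leNgt; apply/negP.
  - by move=> /h1; rewrite ltnNge N1n.
  - by move=> /h2; rewrite ltnNge N2n.
(* Separation involves two indices at a time, so it passes to unions of chains. *)
have [|J [sJ maxJ]] := @Zorn_bigcup nat sep.
  move=> F Fsep Ftot m n [J FJ Jm] [K FK Kn].
  have [JK|KJ] := Ftot _ _ FJ FK.
  - by apply: (Fsep _ FK) => //; exact: JK.
  - by apply: (Fsep _ FJ) => //; exact: KJ.
have [N JN] := bounded _ sJ.
(* All of [J] lies below [N], so finitely many thresholds from [far] have to be exceeded. *)
have [n Nn nfar] : exists2 n, (N <= n)%N & forall m, (m < N)%N ->
    e / 4 <= d (a n) (y m) /\ e / 4 <= d (a m) (y n).
  suff [M hM] : exists M, forall n, (M <= n)%N -> forall m, (m < N)%N ->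
      e / 4 <= d (a n) (y m) /\ e / 4 <= d (a m) (y n).
    by exists (maxn M N); [rewrite leq_maxr|apply: hM; rewrite leq_maxl].
  elim: N {JN} => [|N [M hM]]; first by exists 0%N.
  have [M' hM'] := far N; exists (maxn M M') => n.
  rewrite geq_max => /andP[Mn M'n] m; rewrite ltnS leq_eqVlt => /orP[/eqP->|].
  - exact: hM'.
  - exact: hM.
have nJ : ~ J n by move=> /JN; rewrite ltnNge Nn.
apply: (maxJ (J `|` [set n])).
  by split=> [? ?|JnJ]; [left|apply/nJ/JnJ; right].
have e4 k : e / 4 <= d (a k) (y k) by have := aye k; lra.
move=> k l [Jk|->] [Jl|->] //.
- exact: sJ.
- exact: (nfar _ (JN _ Jk)).2.
- exact: (nfar _ (JN _ Jl)).1.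
Qed.

End Metric.

Section Compatible.
Local Open Scope ring_scope.
Context {R : realType} {X : topologicalType} {d : X -> X -> R}.
Hypothesis dC : compatible_metric d.

Lemma closed_metric_ge x r : closed [set z | r <= d x z].
Proof.
have [dM dopen] := dC.
rewrite -[X in closed X]setCK; apply: open_closedC; apply/dopen => z /= /negP.
rewrite -ltNge => zr; exists (r - d x z); first by rewrite subr_gt0.
move=> w /= zw; apply/negP; rewrite -ltNge.
have := Defs.metric_triangle dM x z w; lra.
Qed.

Lemma closed_metric_point (x : X) : closed [set x].
Proof.
have [dM dopen] := dC.
rewrite -[X in closed X]setCK; apply: open_closedC; apply/dopen => z /= zx.
exists (d z x).
  rewrite lt_neqAle (Defs.metric_ge0 dM) andbT eq_sym; apply/eqP.
  by move=> /(Defs.metric_eq0 dM).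
by move=> w /= zw wx; move: zw; rewrite wx ltxx.
Qed.

Lemma CL_setU1 (A : set X) x : CL A -> CL (A `|` [set x]).
Proof.
move=> [Acl [a Aa]]; split; last by exists a; left.
exact: closedU Acl (closed_metric_point x).
Qed.

End Compatible.

(** * Comparison of two compatible metrics over a bornology *)

Section Comparison.
Local Open Scope ring_scope.
Context {R : realType} {X : topologicalType} {S : set (set X)}.
Context {d rho : X -> X -> R}.
Hypotheses (dC : compatible_metric d) (rhoC : compatible_metric rho).

(** Here [r] may depend on [A], which is all that tests at a fixed limit can detect;
    [proximally_uniformly_finer] removes this dependence. *)
Definition proximally_finer := forall A B (e : R), CL A -> S B -> 0 < e ->
  exists2 r, 0 < r & B `&` enlargement d A r `<=` enlargement rho A e.

Definition uniformly_finer := forall B (e : R), S B -> 0 < e ->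
  exists2 r, 0 < r & forall x y, B x -> d x y < r -> rho x y < e.

Lemma proximally_uniformly_finer : proximally_finer -> uniformly_finer.
Proof.
move=> prox B e SB e0; have [[dM _] [rhoM _]] := (dC, rhoC).
apply: contrapT => nounif.
have /choice[p hp] n : exists q : X * X,
    [/\ B q.1, d q.1 q.2 < n.+1%:R^-1 & e <= rho q.1 q.2].
  apply: contrapT => noq; apply: nounif; exists n.+1%:R^-1.
    by rewrite invr_gt0 ltr0n.
  by move=> x y Bx xyn; rewrite ltNge; apply/negP => exy; apply: noq; exists (x, y).
have [J Junb Jsep] :
    exists2 J : set nat, (forall N, exists2 n, (N <= n)%N & J n) &
    forall m n, J m -> J n -> e / 4 <= rho (p m).1 (p n).2.
  by apply: (efremovich rhoM (fst \o p) (snd \o p)) => // n; have [] := hp n.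
(* Taking all points [rho]-far from the [(p m).1], not just the [(p n).2], gives a closed set
   without passing to a closure. *)
pose C := \bigcap_(m in J) [set z | e / 4 <= rho (p m).1 z].
have CJ n : J n -> C (p n).2 by move=> Jn m Jm; exact: Jsep.
have CLC : CL C.
  split; first by apply: closed_bigI => m _; exact: closed_metric_ge.
  by have [n _ /CJ] := Junb 0%N; exists (p n).2.
have [|r r0 hr] := prox C B (e / 4) CLC SB; first by lra.
have [N hN] := natSinv_lt _ _ r0.
have [n Nn Jn] := Junb N; have [Bn dn _] := hp n.
have /dist_ltP[||z Cz] // : enlargement rho C (e / 4) (p n).1.
- apply: hr; split=> //; apply/(dist_ltP dM); first exact: CLC.2.
  by exists (p n).2; [exact: CJ|exact: lt_trans (hN _ Nn)].
- exact: CLC.2.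
- by apply/negP; rewrite -leNgt; exact: Cz.
Qed.

(** The radius is chosen before [A] because [bconv] also enlarges the moving sets [F i]. *)
Lemma uniformly_finer_enlargement B e : uniformly_finer -> S B -> 0 < e ->
  exists2 r, 0 < r & forall A, A !=set0 ->
    B `&` enlargement d A r `<=` enlargement rho A e.
Proof.
move=> unif SB e0; have [[dM _] [rhoM _]] := (dC, rhoC).
have [r r0 hr] := unif B e SB e0; exists r => // A A0 x [Bx].
move=> /(dist_ltP dM _ _ _ A0)[a Aa xar].
by apply/(dist_ltP rhoM) => //; exists a => //; exact: hr.
Qed.

Lemma uniformly_finer_bconv_plus :
  uniformly_finer -> finer_convergence (bconv_plus S d) (bconv_plus S rho).
Proof.
move=> unif I le F A _ _ [_ A0] dA e B e0 SB.
have [r r0 hr] := uniformly_finer_enlargement B e unif SB e0.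
have [i0 hi0] := dA r B r0 SB; exists i0 => i /hi0 FA x [Fx Bx].
by apply: hr => //; split=> //; exact: FA.
Qed.

Lemma uniformly_finer_bconv :
  uniformly_finer -> finer_convergence (bconv S d) (bconv S rho).
Proof.
move=> unif I le F A _ CLF [_ A0] dA e B e0 SB.
have [r r0 hr] := uniformly_finer_enlargement B e unif SB e0.
have [i0 hi0] := dA r B r0 SB; exists i0 => i /hi0[FA AF].
split=> x [xE Bx]; apply: hr => //.
- by split=> //; exact: FA.
- exact: (CLF i).2.
- by split=> //; exact: AF.
Qed.

Lemma tau_plus_proximally_finer :
  tau_plus S rho `<=` tau_plus S d -> proximally_finer.
Proof.
move=> tau A B e CLA SB e0; have [[dM _] [rhoM _]] := (dC, rhoC).
(* The basic neighborhood need not be open itself, so the inclusion of topologies is applied to an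
   open [U] inside it. *)
have [||U [/tau[_ Uopen] UA UB]] :=
  (@tau_plus_nbhd_base _ _ S rho A (upper_nbhd rho A B e) CLA _).2.
- by move=> C [].
- by exists B => //; exists e.
have [B' SB' [r r0 hr]] := Uopen _ UA; exists r => // x [Bx].
rewrite /enlargement /= => xAr.
have /hr/UB[_ /(_ x Bx)] : upper_nbhd d A B' r (A `|` [set x]).
  split=> [|z _]; first exact: (CL_setU1 dC).
  by have := dist_setU1 dM x z A CLA.2; lra.
(* Evaluated at the added point itself, the [rho]-estimate bounds [dist rho x A] alone. *)
have : dist rho x (A `|` [set x]) <= 0 by apply: dist_mem => //; right.
lra.
Qed.

Lemma bconv_bconv_plus (delta : X -> X -> R) I le (F : I -> set X) A :
  bconv S delta le F A -> bconv_plus S delta le F A.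
Proof.
by move=> cv e B e0 SB; have [i hi] := cv e B e0 SB; exists i => j /hi[].
Qed.

Lemma bconv_proximally_finer :
  finer_convergence (bconv S d) (bconv_plus S rho) -> proximally_finer.
Proof.
move=> fin A B e CLA SB e0; have [[dM _] [rhoM _]] := (dC, rhoC).
apply: contrapT => noprox.
have /choice[x hx] n : exists x : X,
    [/\ B x, dist d x A < n.+1%:R^-1 & e <= dist rho x A].
  apply: contrapT => nox; apply: noprox; exists n.+1%:R^-1.
    by rewrite invr_gt0 ltr0n.
  move=> x [Bx xA]; rewrite /enlargement /= ltNge.
  by apply/negP => exA; apply: nox; exists x.
(* Keeping [A] inside each term makes the lower half of [bconv] automatic; the point [x n] refutes
   [rho]-convergence at every index. *)
pose F n := A `|` [set x n].
have dirnat : directed (fun m n => (m <= n)%N).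
  split; first by exists 0%N.
  - exact: leqnn.
  - by move=> i j k; exact: leq_trans.
  - by move=> i j; exists (maxn i j); [exact: leq_maxl|exact: leq_maxr].
have FA : bconv S d (fun m n => (m <= n)%N) F A.
  move=> r B' r0 _; have [N hN] := natSinv_lt _ _ r0.
  exists N => n Nn; split=> z [zE _]; last first.
    by apply: (le_lt_trans _ r0); apply: dist_mem => //; left.
  case: zE => [Az|->].
    by apply: (le_lt_trans _ r0); exact: dist_mem.
  by have [_ xnA _] := hx n; exact: lt_trans xnA (hN _ Nn).
have CLF n : CL (F n) by exact: (CL_setU1 dC).
have [n /(_ n (leqnn n) (x n))] := fin _ _ F A dirnat CLF CLA FA e B e0 SB.
have [Bx _ exA] := hx n.
rewrite /enlargement /= => h; move: exA; rewrite leNgt h //.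
by split=> //; right.
Qed.

End Comparison.

Theorem theorem4p9 (R : realType) (X : topologicalType)
  (two_points : exists x y : X, x <> y)
  (S : set (set X)) (bS : bornology S)
  (d rho : X -> X -> R)
  (d_compat : compatible_metric d) (rho_compat : compatible_metric rho) :
  let i := tau_plus S rho `<=` tau_plus S d in
  let ii := finer_convergence (bconv S d) (bconv S rho) in
  let iii := finer_convergence (bconv_plus S d) (bconv_plus S rho) in
  (i -> ii) /\ (ii <-> iii).
Proof.
move=> i ii iii.
have unif := proximally_uniformly_finer d_compat rho_compat.
have cvu := bconv_proximally_finer d_compat rho_compat.
have uii := uniformly_finer_bconv d_compat rho_compat.
have uiii := uniformly_finer_bconv_plus d_compat rho_compat.
split; first by move=> /(tau_plus_proximally_finer d_compat rho_compat)/unif/uii.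
split=> fin; [apply/uiii/unif/cvu|apply/uii/unif/cvu] => I le F A dir CLF CLA cv.
- exact/bconv_bconv_plus/fin.
- exact/fin/bconv_bconv_plus.
Qed.
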